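(* Let $\mathcal{A}$ be a separable $C^*$-algebra with multiplier algebra $M(\mathcal{A})$, and let $T$ be a regular operator on $\mathcal{A}$ with $z$-transform $z$. Let $S$ be a regular operator on $\mathcal{A}$ with $z$-transform $z_S$. Then $S$ is an extension of $T$ if and only if $z_S=uz$ for some coisometry $u\in M(\mathcal{A})$ (i.e. $uu^*=I$) satisfying $$(u(I-zz^* )u^* )^{1/2}=u(I-zz^* )^{1/2}.$$
   Context: A $C^*$-algebra $\mathcal{A}$ is viewed as a Hilbert module over itself with $\langle a,b\rangle=a^*b$. An operator $T$ on $\mathcal{A}$ is a linear map from a linear subspace $D(T)\subseteq\mathcal{A}$ to $\mathcal{A}$; its adjoint (for $D(T)$ dense) has domain $D(T^* )=\{y:\exists z,\ \langle Tx,y\rangle=\langle x,z\rangle\ \forall x\in D(T)\}$ and $T^*y=z$. $T$ is semiregular if (a) $D(T)$ is a dense right ideal of $\mathcal{A}$, (b) $T$ is closable, (c) $T^*$ is densely defined. $T$ is regular if it is a closed semiregular operator such that the range of $I+T^*T$ is dense in $\mathcal{A}$. A regular operator $T$ on $\mathcal{A}$ is uniquely determined by its $z$-transform (bounded transform) $z=T(I+T^*T)^{-1/2}\in M(\mathcal{A})$; one has $D(T)=(I-z^*z)^{1/2}\mathcal{A}$ and $T(I-z^*z)^{1/2}a=za$ for $a\in\mathcal{A}$. The $z$-transforms of regular operators are exactly the elements $z\in M(\mathcal{A})$ with $\|z\|\le 1$ and $(I-z^*z)^{1/2}\mathcal{A}$ dense in $\mathcal{A}$. $S$ is an extension of $T$,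 written $T\subseteq S$, if $D(T)\subseteq D(S)$ and $S=T$ on $D(T)$. *)

(* Defs.v *)
From HB Require Import structures.
From mathcomp Require Import all_boot all_order all_algebra.
From mathcomp Require Import all_classical all_reals.
From mathcomp Require Import topology normedtype.
From mathcomp Require Export complex.

Set Implicit Arguments.
Unset Strict Implicit.
Unset Printing Implicit Defensive.

Import Order.TTheory GRing.Theory Num.Theory numFieldNormedType.Exports.

Local Open Scope classical_set_scope.
Local Open Scope ring_scope.
Local Open Scope complex_scope.

Reserved Notation "a ** b" (at level 40, left associativity).
Reserved Notation "u ^*m" (at level 1, left associativity, format "u ^*m").

(* A C*-algebra need not be unital, so its product cannot come from the
   (unital) ring structures of the library. *)
HB.mixin Record isCStarAlgebra (R : realType) A
    of CompleteNormedModule R[i] A := {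
  cmul : A -> A -> A;
  cstar : A -> A;
  cmulA : associative cmul;
  cmulDl : left_distributive cmul +%R;
  cmulDr : right_distributive cmul +%R;
  cmulZl : forall (k : R[i]) (a b : A), cmul (k *: a) b = k *: cmul a b;
  cmulZr : forall (k : R[i]) (a b : A), cmul a (k *: b) = k *: cmul a b;
  cstarK : involutive cstar;
  cstarD : {morph cstar : a b / a + b};
  cstarZ : forall (k : R[i]) (a : A), cstar (k *: a) = Num.conj k *: cstar a;
  cstarM : forall a b : A, cstar (cmul a b) = cmul (cstar b) (cstar a);
  norm_cmul : forall a b : A, `|cmul a b| <= `|a| * `|b|;
  norm_cstar_mul : forall a : A, `|cmul (cstar a) a| = `|a| ^+ 2
}.

#[short(type="cstarAlgType")]
HB.structure Definition CStarAlgebra (R : realType) :=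
  {A of isCStarAlgebra R A & CompleteNormedModule R[i] A}.

Declare Scope cstar_scope.
Delimit Scope cstar_scope with cstar.
Notation "a ** b" := (cmul a b) : cstar_scope.
Local Open Scope cstar_scope.

Definition separable (T : topologicalType) : Prop :=
  exists2 D : set T, countable D & dense D.

Section Multiplier.
Context {R : realType} {A : cstarAlgType R}.

(* Double centralizers (L, R), in Busby's form: linearity, boundedness,
   L (a b) = (L a) b and R (a b) = a (R b) follow from the single axiom. *)
Record multiplier := Multiplier {
  mleft : A -> A;
  mright : A -> A;
  multiplierP : forall a b, a ** mleft b = mright a ** b }.

HB.instance Definition _ := gen_eqMixin multiplier.
HB.instance Definition _ := gen_choiceMixin multiplier.

Lemma multiplier_ext (u v : multiplier) :
  mleft u =1 mleft v -> mright u =1 mright v -> u = v.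
Proof.
case: u v => [f g fg] [f' g' fg'] /= /funext ef /funext eg.
by subst f' g'; congr Multiplier; exact: Prop_irrelevance.
Qed.

Lemma cmul0l (a : A) : 0 ** a = 0.
Proof. by apply: (addrI (0 ** a)); rewrite -cmulDl !addr0. Qed.

Lemma cmul0r (a : A) : a ** 0 = 0.
Proof. by apply: (addrI (a ** 0)); rewrite -cmulDr !addr0. Qed.

Lemma cmulNl (a b : A) : (- a) ** b = - (a ** b).
Proof. by apply: (addrI (a ** b)); rewrite -cmulDl !subrr cmul0l. Qed.

Lemma cmulNr (a b : A) : a ** (- b) = - (a ** b).
Proof. by apply: (addrI (a ** b)); rewrite -cmulDr !subrr cmul0r. Qed.

Fact mzero_subproof (a b : A) : a ** 0 = 0 ** b.
Proof. by rewrite cmul0l cmul0r. Qed.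
Definition mzero := Multiplier mzero_subproof.

Fact mopp_subproof u (a b : A) : a ** (- mleft u b) = (- mright u a) ** b.
Proof. by rewrite cmulNl cmulNr multiplierP. Qed.
Definition mopp u := Multiplier (mopp_subproof u).

Fact madd_subproof u v (a b : A) :
  a ** (mleft u b + mleft v b) = (mright u a + mright v a) ** b.
Proof. by rewrite cmulDl cmulDr !multiplierP. Qed.
Definition madd u v := Multiplier (madd_subproof u v).

Fact mone_subproof (a b : A) : a ** b = a ** b.
Proof. by []. Qed.
Definition mone := Multiplier mone_subproof.

Fact mmul_subproof u v (a b : A) :
  a ** mleft u (mleft v b) = mright v (mright u a) ** b.
Proof. by rewrite !multiplierP. Qed.
Definition mmul u v := Multiplier (mmul_subproof u v).

Fact mstar_subproof u (a b : A) :
  a ** cstar (mright u (cstar b)) = cstar (mleft u (cstar a)) ** b.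
Proof.
by rewrite -[a in LHS]cstarK -cstarM -multiplierP cstarM cstarK.
Qed.
Definition mstar u := Multiplier (mstar_subproof u).

Fact maddA : associative madd.
Proof. by move=> u v w; apply: multiplier_ext => a /=; rewrite addrA. Qed.
Fact maddC : commutative madd.
Proof. by move=> u v; apply: multiplier_ext => a /=; rewrite addrC. Qed.
Fact madd0 : left_id mzero madd.
Proof. by move=> u; apply: multiplier_ext => a /=; rewrite add0r. Qed.
Fact maddN : left_inverse mzero mopp madd.
Proof. by move=> u; apply: multiplier_ext => a /=; rewrite addNr. Qed.

HB.instance Definition _ :=
  GRing.isZmodule.Build multiplier maddA maddC madd0 maddN.

Lemma cstar_mulIr (x y : A) : (forall a, a ** x = a ** y) -> x = y.
Proof.
move=> exy; apply/subr0_eq/eqP; rewrite -normr_eq0 -[_ == _]andbT.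
have : `|x - y| ^+ 2 = 0.
  by rewrite -norm_cstar_mul cmulDr cmulNr exy subrr normr0.
by move/eqP; rewrite sqrf_eq0 => ->.
Qed.

Lemma cstar_mulIl (x y : A) : (forall a, x ** a = y ** a) -> x = y.
Proof.
move=> exy; apply/(can_inj cstarK)/cstar_mulIr => a.
by rewrite -[a]cstarK -!cstarM exy.
Qed.

Lemma mleftD u : {morph mleft u : a b / a + b}.
Proof.
by move=> a b; apply: cstar_mulIr => c; rewrite cmulDr !multiplierP cmulDr.
Qed.

Lemma mrightD u : {morph mright u : a b / a + b}.
Proof.
by move=> a b; apply: cstar_mulIl => c; rewrite cmulDl -!multiplierP cmulDl.
Qed.

Fact mmulA : associative mmul.
Proof. by move=> u v w; apply: multiplier_ext. Qed.
Fact mmul1l : left_id mone mmul.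
Proof. by move=> u; apply: multiplier_ext. Qed.
Fact mmul1r : right_id mone mmul.
Proof. by move=> u; apply: multiplier_ext. Qed.
Fact mmulDl : left_distributive mmul +%R.
Proof. by move=> u v w; apply: multiplier_ext => a //=; rewrite mrightD. Qed.
Fact mmulDr : right_distributive mmul +%R.
Proof. by move=> u v w; apply: multiplier_ext => a //=; rewrite mleftD. Qed.

HB.instance Definition _ := GRing.Zmodule_isPzRing.Build multiplier
  mmulA mmul1l mmul1r mmulDl mmulDr.

Definition mpositive (a : multiplier) : Prop :=
  exists c : multiplier, a = mstar c * c.

Definition is_msqrt (a b : multiplier) : Prop := mpositive b /\ b * b = a.

(* The positive square root; it exists and is unique for positive a. *)
Definition msqrt (a : multiplier) : multiplier := xget 0 [set b | is_msqrt a b].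

End Multiplier.
Arguments multiplier {R} A.

Notation "u ^*m" := (mstar u) : ring_scope.

Section Operator.
Context {R : realType} {A : cstarAlgType R}.

(* A partially defined map; the values of [op] outside [dom] are irrelevant. *)
Record operator := Operator { dom : set A; op :> A -> A }.

Definition linear_operator (T : operator) : Prop :=
  dom T 0 /\
  forall (k : R[i]) (x y : A), dom T x -> dom T y ->
    dom T (k *: x + y) /\ T (k *: x + y) = k *: T x + T y.

Definition inner (a b : A) : A := cstar a ** b.

Definition is_adjoint_value (T : operator) (y z : A) : Prop :=
  forall x, dom T x -> inner (T x) y = inner x z.

(* When [dom T] is dense, the value [z] is unique. *)
Definition adjoint (T : operator) : operator := {|
  dom := [set y | exists z, is_adjoint_value T y z];
  op := fun y => xget 0 [set z | is_adjoint_value T y z] |}.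

Definition comp_op (S T : operator) : operator := {|
  dom := [set x | dom T x /\ dom S (T x)];
  op := fun x => S (T x) |}.

Definition id_add_op (T : operator) : operator := {|
  dom := dom T;
  op := fun x => x + T x |}.

Definition range_op (T : operator) : set A := T @` dom T.

Definition graph (T : operator) : set (A * A) :=
  [set p | dom T p.1 /\ T p.1 = p.2].

Definition extends (S T : operator) : Prop :=
  dom T `<=` dom S /\ forall x, dom T x -> S x = T x.

Definition closable (T : operator) : Prop := forall x y y',
  closure (graph T) (x, y) -> closure (graph T) (x, y') -> y = y'.

Definition closed_operator (T : operator) : Prop := closed (graph T).

Definition semiregular (T : operator) : Prop :=
  [/\ linear_operator T,
      dense (dom T) /\ (forall x a, dom T x -> dom T (x ** a)),
      closable T
    & dense (dom (adjoint T))].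

Definition regular (T : operator) : Prop :=
  [/\ semiregular T, closed_operator T
    & dense (range_op (id_add_op (comp_op (adjoint T) T)))].

(* The everywhere defined operator a |-> r a is the inverse of [N]. *)
Definition is_inverse_op (N : operator) (r : multiplier A) : Prop :=
  (forall a, dom N (mleft r a) /\ N (mleft r a) = a) /\
  (forall x, dom N x -> mleft r (N x) = x).

(* z = T (I + T^* T)^{-1/2}, with r = (I + T^* T)^{-1} and q = r^{1/2}. *)
Definition is_ztransform (T : operator) (z : multiplier A) : Prop :=
  exists r q : multiplier A,
    [/\ is_inverse_op (id_add_op (comp_op (adjoint T) T)) r,
        is_msqrt r q
      & forall a, dom T (mleft q a) /\ T (mleft q a) = mleft z a].

End Operator.
Arguments operator {R} A.

(* Main.v *)
From HB Require Import structures.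
Require Import Defs.
From mathcomp Require Import all_boot all_order all_algebra.
From mathcomp Require Import all_classical all_reals.
From mathcomp Require Import topology normedtype ring lra.

(** Write [q = (1 - z^*m z)^(1/2)] and [p = (1 - z z^*m)^(1/2)], and likewise
[q'] and [p'] for the transform [z'] of [S].

The operator [T] is [q a |-> z a], and every [x] of its domain is [q a] for
[a = q x + z^*m (T x)] (lemma [ztransformP]).  Hence [S] extends [T] if and only
if [q = q' w] and [z = z' w] for some multiplier [w], namely
[w = q' q + z'^*m z] (lemma [extends_factor]).  Since [p z = z q] and
[p' z' = z' q'], the multiplier [u = p' p + z' z^*m] then satisfies [u z = z']
and [u p = p'] (lemma [adjoint_factor]; this expresses that the adjoint of [T]
extends the adjoint of [S]), so that [u u^*m = p'^2 + z' z'^*m = 1].  The same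
lemma, applied to [z'^*m] and [z^*m], goes back from [u] to [w].  Finally, if
[u] is a coisometry with [z' = u z], then [u (1 - z z^*m) u^*m = 1 - z' z'^*m],
whose square root is [p']; so the condition on square roots is [p' = u p].

This rests on the following facts on the multiplier algebra: [z] is a
contraction, [1 - z z^*m] has a positive square root, and positive square roots
of intertwined multipliers are intertwined, which gives [p z = z q] and also
the uniqueness of the root.  They are proved here without spectral theory.
Multipliers are automatically bounded (lemma [multiplier_bounded]), and the
norm enters through the predicate [mbound u C], for an operator norm at most
[C].  A self-adjoint [h] is called positive if the norm of [t - h] is at most
[t] for some real [t]; the iteration [y |-> (x + y^2) / 2] then provides a
square root of [h] that respects intertwining.  Conversely, squares of
self-adjoint [k] are positive because, for [s^2 + k^2 = t] with [s] and [k]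
commuting, [s + i k] is normal of norm [t^(1/2)], whence [s] has norm at most
[t^(1/2)].  Uniqueness of roots and Kaplansky's theorem that every [x^*m x] is
positive (lemma [positive_star_mul]) follow by algebra: [x] is multiplied by
the negative part of [x^*m x], which reduces the matter to the case
[x^*m x = - k^2], and there [x] vanishes because it intertwines a positive
multiplier with a negative one (lemma [positive_sylvester]). *)

Set Implicit Arguments.
Unset Strict Implicit.
Unset Printing Implicit Defensive.

Import Order.TTheory GRing.Theory Num.Theory numFieldNormedType.Exports.

Local Open Scope classical_set_scope.
Local Open Scope ring_scope.
Local Open Scope complex_scope.
Local Open Scope cstar_scope.

(** * The real-valued norm of the algebra *)

Section RealNorm.
Context {R : realType} {A : cstarAlgType R}.
Implicit Types (a b : A) (k : R[i]) (t : R).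

(** The norm of the algebra takes its values in the nonnegative reals of
[R[i]]; [rnorm] is the same norm with values in [R]. *)
Definition rnorm a : R := complex.Re `|a|.

Lemma normE a : `|a| = (rnorm a)%:C.
Proof. by rewrite /rnorm RRe_real// ger0_real. Qed.

Lemma rnorm_ge0 a : 0 <= rnorm a.
Proof. by rewrite -ler0c -normE. Qed.

Lemma rnorm0 : rnorm (0 : A) = 0.
Proof. by rewrite /rnorm normr0. Qed.

Lemma rnorm_eq0 a : rnorm a = 0 -> a = 0.
Proof. by move=> a0; apply/eqP; rewrite -normr_eq0 normE a0. Qed.

Lemma rnormD a b : rnorm (a + b) <= rnorm a + rnorm b.
Proof. by rewrite -lecR rmorphD /= -!normE; exact: ler_normD. Qed.

Lemma rnormN a : rnorm (- a) = rnorm a.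
Proof. by rewrite /rnorm normrN. Qed.

Lemma rnormB a b : rnorm (a - b) = rnorm (b - a).
Proof. by rewrite -rnormN opprB. Qed.

Lemma rnormZ k a : rnorm (k *: a) = complex.Re `|k| * rnorm a.
Proof.
by apply: complexI; rewrite -normE normrZ normE rmorphM /= RRe_real// ger0_real.
Qed.

Lemma rnormZr t a : 0 <= t -> rnorm (t%:C *: a) = t * rnorm a.
Proof. by move=> t0; rewrite rnormZ ger0_norm // ler0c. Qed.

Lemma rnormM a b : rnorm (a ** b) <= rnorm a * rnorm b.
Proof. by rewrite -lecR rmorphM /= -!normE norm_cmul. Qed.

Lemma rnorm_cstar_mul a : rnorm (cstar a ** a) = rnorm a ^+ 2.
Proof. by apply: complexI; rewrite -normE norm_cstar_mul normE rmorphXn. Qed.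

Lemma rnorm_cstar a : rnorm (cstar a) = rnorm a.
Proof.
have le_cstar b : rnorm b <= rnorm (cstar b).
  have [->|b0] := eqVneq (rnorm b) 0; first exact: rnorm_ge0.
  have b1 : 0 < rnorm b by rewrite lt_def b0 rnorm_ge0.
  by rewrite -(ler_pM2r b1) -expr2 -rnorm_cstar_mul rnormM.
by apply/le_anti; rewrite [X in _ && X]le_cstar andbT -[in leRHS](cstarK a) le_cstar.
Qed.

(** Completeness, for sequences whose increments are dominated by those of a
bounded sequence of reals. *)
Lemma dominated_limit (x : nat -> A) (s : nat -> R) (C : R) :
    (forall n, rnorm (x n.+1 - x n) <= s n.+1 - s n) ->
    (forall n, s n <= C) ->
  exists l, forall n, rnorm (l - x n) <= C - s n.
Proof.
move=> dx sC.
have dxm n m : rnorm (x (n + m)%N - x n) <= s (n + m)%N - s n.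
  elim: m => [|m IHm]; first by rewrite addn0 !subrr rnorm0.
  rewrite addnS; have := dx (n + m)%N.
  have := rnormD (x (n + m).+1 - x (n + m)%N) (x (n + m)%N - x n).
  by rewrite addrA subrK; lra.
have hs : has_sup (range s).
  by split; [exists (s 0%N), 0%N | exists C => _ [n _ <-]].
have ssup n : s n <= sup (range s).
  by apply: sup_upper_bound => //; exists n.
have cx : cauchy (x @ \oo).
  apply: cauchy_exP => e e0.
  have Re_gt0 : 0 < complex.Re e by move: e0; rewrite ltcE => /andP[].
  have [_ [n _ <-] sn] := sup_adherent Re_gt0 hs.
  exists (x n), n => // m /= nm; rewrite -ball_normE /ball_ /= normE.
  have eE : e = (complex.Re e)%:C by rewrite RRe_real// gtr0_real.
  rewrite eE ltcR rnormB; have := dxm n (m - n)%N; rewrite subnKC //.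
  by have := ssup m; lra.
have /cauchy_cvg /cvg_ex [l xl] := cx.
exists l => n; apply/ler_addgt0Pr => e e0.
have eC : 0 < e%:C :> R[i] by rewrite ltcR.
have /cvgrPdist_lt /(_ _ eC) [N _ lN] := xl.
have /= := lN (maxn N n) (leq_maxl _ _); rewrite normE ltcR => lx.
have := dxm n (maxn N n - n)%N; rewrite subnKC ?leq_maxr // => xx.
have := rnormD (l - x (maxn N n)) (x (maxn N n) - x n).
by rewrite addrA subrK; have := sC (maxn N n); lra.
Qed.

End RealNorm.

(** * Multipliers as a unital involutive algebra *)

Section MultiplierStar.
Context {R : realType} {A : cstarAlgType R}.
Implicit Types (a b : A) (k : R[i]) (t e : R) (u v w : multiplier A).

Lemma mleftZ u k a : mleft u (k *: a) = k *: mleft u a.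
Proof.
by apply: cstar_mulIr => c; rewrite cmulZr !multiplierP cmulZr.
Qed.

Lemma mleft0 u : mleft u 0 = 0.
Proof. by apply: (addrI (mleft u 0)); rewrite -mleftD !addr0. Qed.

Lemma mleftN u a : mleft u (- a) = - mleft u a.
Proof. by apply: (addrI (mleft u a)); rewrite -mleftD !subrr mleft0. Qed.

Lemma mleftB u a b : mleft u (a - b) = mleft u a - mleft u b.
Proof. by rewrite mleftD mleftN. Qed.

(** The action on the left determines a multiplier. *)
Lemma mleft_inj u v : mleft u =1 mleft v -> u = v.
Proof.
move=> uv; apply: multiplier_ext => // a; apply: cstar_mulIl => b.
by rewrite -!multiplierP uv.
Qed.

Lemma inner_mstarl u a b : cstar (mleft u a) ** b = cstar a ** mleft u^*m b.
Proof. by rewrite multiplierP /= cstarK. Qed.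

Lemma inner_mstarr u a b : cstar (mleft u^*m a) ** b = cstar a ** mleft u b.
Proof. by rewrite multiplierP /= cstarK. Qed.

Lemma mstarK : involutive (@mstar R A).
Proof. by move=> u; apply: multiplier_ext => a; rewrite /= !cstarK. Qed.

Lemma mstarD u v : (u + v)^*m = u^*m + v^*m.
Proof. by apply: multiplier_ext => a; rewrite /= cstarD. Qed.

Lemma mstarM u v : (u * v)^*m = v^*m * u^*m.
Proof. by apply: multiplier_ext => a; rewrite /= cstarK. Qed.

Lemma mstar0 : (0 : multiplier A)^*m = 0.
Proof. by apply: (addrI 0^*m); rewrite -mstarD !addr0. Qed.

Lemma mstarN u : (- u)^*m = - u^*m.
Proof. by apply: (addrI u^*m); rewrite -mstarD !subrr mstar0. Qed.

Lemma mstarB u v : (u - v)^*m = u^*m - v^*m.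
Proof. by rewrite mstarD mstarN. Qed.

Lemma mstar1 : (1 : multiplier A)^*m = 1.
Proof. by apply: multiplier_ext => a; rewrite /= cstarK. Qed.

Fact mscal_subproof k a b : a ** (k *: b) = (k *: a) ** b.
Proof. by rewrite cmulZr cmulZl. Qed.

(** Multiplication by a scalar, as a central multiplier. *)
Definition mscal k : multiplier A := Multiplier (mscal_subproof k).

Fact mscal_is_zmod_morphism : zmod_morphism mscal.
Proof.
by move=> k l; apply: multiplier_ext => a; rewrite /= scalerBl.
Qed.

Fact mscal_is_monoid_morphism : monoid_morphism mscal.
Proof.
split=> [|k l]; apply: multiplier_ext => a /=; rewrite ?scale1r ?scalerA //.
by rewrite mulrC.
Qed.

HB.instance Definition _ :=
  GRing.isZmodMorphism.Build _ _ mscal mscal_is_zmod_morphism.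
HB.instance Definition _ :=
  GRing.isMonoidMorphism.Build _ _ mscal mscal_is_monoid_morphism.

Lemma mscalC k u : mscal k * u = u * mscal k.
Proof. by apply: mleft_inj => a; rewrite /= mleftZ. Qed.

Lemma mstar_mscal k : (mscal k)^*m = mscal (Num.conj k).
Proof. by apply: multiplier_ext => a; rewrite /= cstarZ cstarK. Qed.

Lemma mscal_inv k u v : k != 0 -> mscal k * u = mscal k * v -> u = v.
Proof.
move=> k0 /(congr1 (fun w => mscal k^-1 * w)).
by rewrite !mulrA -!rmorphM mulVf //= !rmorph1 !mul1r.
Qed.

(** The real scalars and the imaginary unit, as multipliers. *)
Definition mreal t := mscal t%:C.
Definition mimag := mscal 'i%C.

Lemma mrealD t e : mreal (t + e) = mreal t + mreal e :> multiplier A.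
Proof. by rewrite /mreal !rmorphD. Qed.

Lemma mrealB t e : mreal (t - e) = mreal t - mreal e :> multiplier A.
Proof. by rewrite /mreal !rmorphB. Qed.

Lemma mrealM t e : mreal (t * e) = mreal t * mreal e :> multiplier A.
Proof. by rewrite /mreal !rmorphM. Qed.

Lemma mreal1 : mreal 1 = 1 :> multiplier A.
Proof. by rewrite /mreal !rmorph1. Qed.

Lemma mrealC t u : mreal t * u = u * mreal t.
Proof. exact: mscalC. Qed.

Lemma mreal_inv t u v : t != 0 -> mreal t * u = mreal t * v -> u = v.
Proof.
by move=> t0; apply: mscal_inv; rewrite (inj_eq (@complexI _) t 0).
Qed.

Lemma mreal2M u : mreal 2 * u = u + u.
Proof. by rewrite (_ : 2 = 1 + 1 :> R)// mrealD mreal1 mulrDl mul1r. Qed.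

Lemma mimag_sqr : mimag * mimag = -1.
Proof. by rewrite -rmorphM /= -expr2 sqr_i rmorphN rmorph1. Qed.

Lemma mimagC u : mimag * u = u * mimag.
Proof. exact: mscalC. Qed.

Lemma mstar_mimag : mimag^*m = - mimag.
Proof. by rewrite mstar_mscal complexiE conjCi rmorphN. Qed.

(** Fixed points of the involution. *)
Definition selfadjoint u := u^*m = u.

Lemma selfadjoint_real t : selfadjoint (mreal t).
Proof.
by rewrite /selfadjoint mstar_mscal conj_Creal //; apply/complex_realP; exists t.
Qed.

Lemma selfadjointD u v : selfadjoint u -> selfadjoint v -> selfadjoint (u + v).
Proof. by move=> su sv; rewrite /selfadjoint mstarD su sv. Qed.

Lemma selfadjointB u v : selfadjoint u -> selfadjoint v -> selfadjoint (u - v).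
Proof. by move=> su sv; rewrite /selfadjoint mstarB su sv. Qed.

Lemma selfadjointM u v : selfadjoint u -> selfadjoint v -> u * v = v * u ->
  selfadjoint (u * v).
Proof. by move=> su sv uv; rewrite /selfadjoint mstarM su sv. Qed.

Lemma selfadjoint_realM t u : selfadjoint u -> selfadjoint (mreal t * u).
Proof.
by move=> su; apply: selfadjointM => //; [exact: selfadjoint_real|exact: mrealC].
Qed.

End MultiplierStar.

Section MultiplierBound.
Context {R : realType} {A : cstarAlgType R}.
Implicit Types (a b : A) (k : R[i]) (u v w : multiplier A) (C D t e : R).

(** The multiplier [u] has operator norm at most [C]. *)
Definition mbound u C := 0 <= C /\ forall a, rnorm (mleft u a) <= C * rnorm a.

Lemma mbound_le u C D : C <= D -> mbound u C -> mbound u D.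
Proof.
move=> CD [C0 uC]; split=> [|a]; first exact: le_trans CD.
by apply: le_trans (uC a) _; rewrite ler_wpM2r// rnorm_ge0.
Qed.

Lemma mboundD u v C D : mbound u C -> mbound v D -> mbound (u + v) (C + D).
Proof.
move=> [C0 uC] [D0 vD]; split=> [|a]; first exact: addr_ge0.
by rewrite (le_trans (rnormD _ _))// mulrDl lerD.
Qed.

Lemma mboundN u C : mbound u C -> mbound (- u) C.
Proof. by move=> [C0 uC]; split=> // a; rewrite /= rnormN. Qed.

Lemma mboundB u v C D : mbound u C -> mbound v D -> mbound (u - v) (C + D).
Proof. by move=> uC vD; apply: mboundD => //; apply: mboundN. Qed.

Lemma mboundM u v C D : mbound u C -> mbound v D -> mbound (u * v) (C * D).
Proof.
move=> [C0 uC] [D0 vD]; split=> [|a]; first exact: mulr_ge0.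
by rewrite (le_trans (uC _))// -mulrA ler_wpM2l.
Qed.

Lemma mbound0 : mbound 0 0.
Proof. by split=> // a; rewrite mul0r rnorm0. Qed.

Lemma mbound_real t : 0 <= t -> mbound (mreal t) t.
Proof. by move=> t0; split=> // a; rewrite /= rnormZr. Qed.

Lemma mbound_star u C : mbound u C -> mbound u^*m C.
Proof.
move=> [C0 uC]; split=> // a; set b := mleft u^*m a.
have [b0|b0] := eqVneq (rnorm b) 0; first by rewrite b0 mulr_ge0 ?rnorm_ge0.
have b1 : 0 < rnorm b by rewrite lt_def b0 rnorm_ge0.
rewrite -(ler_pM2r b1) -expr2 -rnorm_cstar_mul inner_mstarr.
apply: le_trans (rnormM _ _) _; rewrite rnorm_cstar.
by rewrite -mulrA mulrCA ler_wpM2l// rnorm_ge0.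
Qed.

Lemma rnorm_mright u C a : mbound u C -> rnorm (mright u a) <= C * rnorm a.
Proof.
by move/mbound_star => [_ /(_ (cstar a))] /=; rewrite cstarK !rnorm_cstar.
Qed.

(** One half of the C*-identity for the operator norm. *)
Lemma mbound_star_mul u D : 0 <= D -> mbound (u^*m * u) (D ^+ 2) -> mbound u D.
Proof.
move=> D0 [_ uD]; split=> // a.
rewrite -(@ler_pXn2r _ 2) ?nnegrE ?mulr_ge0 ?rnorm_ge0 //.
rewrite -rnorm_cstar_mul inner_mstarl.
apply: le_trans (rnormM _ _) _; rewrite rnorm_cstar.
by have := uD a; have := rnorm_ge0 a; nra.
Qed.

Lemma mbound_eq0 u : (forall e, 0 < e -> mbound u e) -> u = 0.
Proof.
move=> ue; apply: mleft_inj => a /=; apply: rnorm_eq0; apply/le_anti.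
rewrite rnorm_ge0 andbT; apply/ler_addgt0Pr => e e0; rewrite add0r.
have a0 := rnorm_ge0 a.
have a1 : 0 < 1 + rnorm a by lra.
have [_ /(_ a) /le_trans] := ue (e / (1 + rnorm a)) (divr_gt0 e0 a1).
by apply; rewrite -mulrA ler_piMr ?(ltW e0)// [_^-1 * _]mulrC ler_pdivrMr//; lra.
Qed.

Lemma star_mul_eq0 u : u^*m * u = 0 -> u = 0.
Proof.
move=> uu; apply: mbound_eq0 => e e0; apply: mbound_star_mul; first exact: ltW.
by rewrite uu; apply: mbound_le mbound0; rewrite exprn_ge0// (ltW e0).
Qed.

Lemma selfadjoint_sqr_eq0 u : selfadjoint u -> u * u = 0 -> u = 0.
Proof. by move=> su uu; apply: star_mul_eq0; rewrite su. Qed.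

(** Multipliers are automatically bounded: otherwise a gliding hump yields a
point at which the maps [a |-> mright u b ** a = b ** mleft u a] are unbounded
as [b] ranges over the unit ball. *)
Lemma multiplier_bounded u : exists C, mbound u C.
Proof.
apply: contrapT => unbounded.
have hump (C : R) : 0 <= C -> exists b, C * rnorm b < rnorm (mright u b).
  move=> C0; apply: contrapT => bC; apply: unbounded; exists C.
  rewrite -[u]mstarK; apply: mbound_star; split=> // a.
  rewrite /= rnorm_cstar -(rnorm_cstar a) leNgt; apply/negP => aC.
  by apply: bC; exists (cstar a).
pose K n : R := 6 * 4 ^+ n * n%:R.
have K0 n : 0 <= K n by rewrite !mulr_ge0 ?exprn_ge0.
have /choice [b bK] : forall n, exists b, K n * rnorm b < rnorm (mright u b).
  by move=> n; apply: hump.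
pose c n := mright u (b n).
have c0 n : 0 < rnorm (c n).
  by apply: le_lt_trans (bK n); rewrite mulr_ge0 ?rnorm_ge0.
(* Each step moves by at most [4 ^- n], to a point where [c n] acts as
   something of norm at least [4 ^- n * rnorm (c n) / 2]. *)
have step n x : exists y, rnorm (y - x) <= 4 ^- n /\
    4 ^- n * rnorm (c n) / 2 <= rnorm (c n ** y).
  pose d := (4 ^- n / rnorm (c n))%:C *: cstar (c n).
  have p0 : 0 <= 4 ^- n / rnorm (c n) :> R.
    by rewrite divr_ge0 ?invr_ge0 ?exprn_ge0 ?rnorm_ge0.
  have dn : rnorm d = 4 ^- n.
    by rewrite rnormZr// rnorm_cstar mulfVK// gt_eqF.
  have cd : rnorm (c n ** d) = 4 ^- n * rnorm (c n).
    rewrite cmulZr rnormZr// -{2}[c n]cstarK rnorm_cstar_mul rnorm_cstar expr2.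
    by rewrite mulrA mulfVK// gt_eqF.
  have [cx|cx] := leP (4 ^- n * rnorm (c n) / 2) (rnorm (c n ** x)).
    by exists x; split=> //; rewrite subrr rnorm0 invr_ge0 exprn_ge0.
  exists (x + d); rewrite [x + d]addrC addrK dn; split=> //.
  rewrite cmulDr; have := rnormD (c n ** d + c n ** x) (- (c n ** x)).
  by rewrite addrK rnormN cd; lra.
have /choice [next nextP] : forall p : nat * A, exists y,
    rnorm (y - p.2) <= 4 ^- p.1 /\
    4 ^- p.1 * rnorm (c p.1) / 2 <= rnorm (c p.1 ** y).
  by move=> [n x]; exact: step.
pose fix x n : A := if n is m.+1 then next (m, x m) else 0.
have q0 n : 0 < 4 ^- n :> R by rewrite invr_gt0 exprn_gt0.
pose s n : R := - (4 / 3 * 4 ^- n).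
have s_step n : s n.+1 - s n = 4 ^- n.
  by rewrite /s exprS invfM; lra.
have [l xl] : exists l, forall n, rnorm (l - x n) <= 0 - s n.
  apply: dominated_limit => n; last by rewrite /s; have := q0 n; lra.
  by rewrite s_step; have [] := nextP (n, x n).
have ul n : n%:R < rnorm (mleft u l).
  have [_ /= cx] := nextP (n, x n); rewrite -[next _]/(x n.+1) in cx.
  have lx := xl n.+1.
  have cl : 4 ^- n * rnorm (c n) / 6 <= rnorm (c n ** l).
    have := rnormD (c n ** l) (c n ** (x n.+1 - l)).
    rewrite -cmulDr [l + _]addrC subrK => cxl.
    have := rnormM (c n) (x n.+1 - l); rewrite rnormB => cxl'.
    have sE : 0 - s n.+1 = 4 ^- n / 3 by rewrite /s exprS invfM; lra.
    rewrite sE in lx; have := ler_wpM2l (ltW (c0 n)) lx; lra.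
  have ub : rnorm (c n ** l) <= rnorm (b n) * rnorm (mleft u l).
    by rewrite -multiplierP rnormM.
  have b0 : 0 < rnorm (b n).
    rewrite lt_def rnorm_ge0 andbT; apply/eqP => /rnorm_eq0 bn0.
    have := c0 n; rewrite /c bn0.
    rewrite (_ : mright u 0 = 0) ?rnorm0 ?ltxx//.
    by apply: (addrI (mright u 0)); rewrite -mrightD !addr0.
  rewrite -(ltr_pM2l b0) (lt_le_trans _ ub)// (lt_le_trans _ cl)//.
  rewrite ltr_pdivlMr// ltr_pdivlMl ?exprn_gt0//.
  by apply: le_lt_trans (bK n); rewrite /K le_eqVlt; apply/orP; left; apply/eqP; ring.
have := ul (Num.truncn (rnorm (mleft u l))).+1.
by rewrite ltNge ltW// truncnS_gt.
Qed.

End MultiplierBound.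

(** * Square roots *)

Section SquareRoot.
Context {R : realType} {A : cstarAlgType R}.
Implicit Types (h u v w x : multiplier A) (C D t e : R).

(** Completeness of the multiplier algebra for the operator norm, in the form
of [dominated_limit]. *)
Lemma multiplier_limit (v : nat -> multiplier A) (s : nat -> R) C :
    (forall n, mbound (v n.+1 - v n) (s n.+1 - s n)) ->
    (forall n, s n <= C) ->
    (forall e, 0 < e -> exists n, C - s n < e) ->
  exists l, forall n, mbound (l - v n) (C - s n).
Proof.
move=> dv sC se.
have limit (f : nat -> A) a : (forall n, rnorm (f n.+1 - f n) <=
    (s n.+1 - s n) * rnorm a) ->
    exists l, forall n, rnorm (l - f n) <= (C - s n) * rnorm a.
  move=> df; have [n||l fl] := @dominated_limit _ _ f
    (fun n => s n * rnorm a) (C * rnorm a).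
  - by rewrite -mulrBl.
  - by move=> n; rewrite ler_wpM2r// rnorm_ge0.
  by exists l => n; rewrite mulrBl.
have /choice [f fP] : forall a, exists l, forall n,
    rnorm (l - mleft (v n) a) <= (C - s n) * rnorm a.
  by move=> a; apply: limit => n; have [_ ->] := dv n.
have /choice [g gP] : forall a, exists l, forall n,
    rnorm (l - mright (v n) a) <= (C - s n) * rnorm a.
  by move=> a; apply: limit => n; exact: (rnorm_mright a (dv n)).
have fg a b : a ** f b = g a ** b.
  apply/subr0_eq/rnorm_eq0/le_anti; rewrite rnorm_ge0 andbT.
  apply/ler_addgt0Pr => e e0; rewrite add0r.
  have a0 := rnorm_ge0 a; have b0 := rnorm_ge0 b.
  have ab0 : 0 < 1 + 2 * (rnorm a * rnorm b) by nra.
  have [n sn] := se _ (divr_gt0 e0 ab0); rewrite ltr_pdivlMr// in sn.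
  have -> : a ** f b - g a ** b =
      a ** (f b - mleft (v n) b) - (g a - mright (v n) a) ** b.
    rewrite cmulDr cmulDl cmulNr cmulNl multiplierP opprD opprK addrACA.
    by rewrite addNr addr0.
  have := rnormD (a ** (f b - mleft (v n) b)) (- ((g a - mright (v n) a) ** b)).
  rewrite rnormN.
  have := rnormM a (f b - mleft (v n) b).
  have := rnormM (g a - mright (v n) a) b.
  have := fP b n; have := gP a n => gn fn gb af ab.
  have {}fn := ler_wpM2l a0 fn; have {}gn := ler_wpM2r b0 gn.
  have := sC n; lra.
exists (Multiplier fg) => n; split=> [|a]; last exact: fP.
by rewrite subr_ge0.
Qed.

(** The iteration [y |-> (x + y ^+ 2) / 2] converges to [1 - sqrt (1 - x)];
the real sequence that it defines for [x = 1] dominates all the others. *)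
Fixpoint sqrt_iter x n : multiplier A :=
  if n is m.+1 then mreal 2^-1 * (x + sqrt_iter x m * sqrt_iter x m) else 0.

Fixpoint sqrt_major n : R :=
  if n is m.+1 then (1 + sqrt_major m ^+ 2) / 2 else 0.

Lemma sqrt_major_itv n : 0 <= sqrt_major n <= 1.
Proof. by elim: n => [|n /andP[s0 s1]] /=; rewrite ?lexx ?ler01//; nra. Qed.

Lemma sqrt_major_le n : sqrt_major n <= sqrt_major n.+1.
Proof. by have := sqrt_major_itv n => /=; nra. Qed.

Lemma sqrt_major_cvg e : 0 < e -> exists n, 1 - sqrt_major n < e.
Proof.
move=> e0.
(* The error [1 - sqrt_major n] is at most [2 / (n + 2)]. *)
have rate n : (1 - sqrt_major n) * (n%:R + 2) <= 2.
  elim: n => [|n IHn]; first by rewrite /=; lra.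
  have /andP[s0 s1] := sqrt_major_itv n.
  have n0 : 0 <= n%:R :> R by [].
  rewrite -natr1 /=; set d := 1 - sqrt_major n in IHn *.
  have -> : 1 - (1 + sqrt_major n ^+ 2) / 2 = d * (2 - d) / 2.
    by rewrite /d; field.
  have d0 : 0 <= d by rewrite /d; lra.
  have d1 : d <= 1 by rewrite /d; lra.
  have : 0 <= (2 - d * (n%:R + 2)) * (2 - d) by rewrite mulr_ge0; lra.
  by have := mulr_ge0 d0 d0; lra.
exists (Num.truncn (2 / e)).+1.
have := rate (Num.truncn (2 / e)).+1.
have : 2 / e < (Num.truncn (2 / e)).+1%:R by exact: truncnS_gt.
rewrite ltr_pdivrMr//; set N := _%:R; set s := sqrt_major _.
move=> eN sN; rewrite ltNge; apply/negP => se.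
have N0 : 0 <= N by exact: ler0n.
nra.
Qed.

Lemma mbound_sub_sqr u v C D e : mbound u C -> mbound v D -> mbound (u - v) e ->
  mbound (u * u - v * v) ((C + D) * e).
Proof.
move=> uC vD uv; have -> : u * u - v * v = u * (u - v) + (u - v) * v.
  by rewrite mulrBr mulrBl addrA subrK.
by rewrite [(C + D) * e]mulrDl [D * e]mulrC; apply: mboundD; apply: mboundM.
Qed.

Lemma mbound_sqrt_iter x n : mbound x 1 -> mbound (sqrt_iter x n) (sqrt_major n).
Proof.
move=> x1; elim: n => [|n IHn] /=; first exact: mbound0.
rewrite [_ / 2]mulrC; apply: mboundM; first by apply: mbound_real; rewrite invr_ge0.
by apply: mboundD => //; apply: mboundM.
Qed.

Lemma mbound_sqrt_step x n : mbound x 1 ->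
  mbound (sqrt_iter x n.+1 - sqrt_iter x n) (sqrt_major n.+1 - sqrt_major n).
Proof.
move=> x1; elim: n => [|n IHn].
  by rewrite !subr0; exact: mbound_sqrt_iter 1%N x1.
have -> : sqrt_iter x n.+2 - sqrt_iter x n.+1 =
    mreal 2^-1 * (sqrt_iter x n.+1 * sqrt_iter x n.+1
                  - sqrt_iter x n * sqrt_iter x n).
  by rewrite [X in X - _]/= [X in _ - X]/= -mulrBr opprD addrACA subrr add0r.
have -> : sqrt_major n.+2 - sqrt_major n.+1 = 2^-1 *
    ((sqrt_major n.+1 + sqrt_major n) * (sqrt_major n.+1 - sqrt_major n)).
  by rewrite /=; lra.
apply: mboundM; first by apply: mbound_real; rewrite invr_ge0.
by apply: mbound_sub_sqr => //; apply: mbound_sqrt_iter.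
Qed.

(** The limit of the iteration, [1 - sqrt (1 - x)], when [x] has norm at most
[1]; the default value [0] is irrelevant. *)
Definition sqrt_lim x : multiplier A :=
  xget 0 [set y | forall n, mbound (y - sqrt_iter x n) (1 - sqrt_major n)].

Lemma sqrt_limP x n : mbound x 1 ->
  mbound (sqrt_lim x - sqrt_iter x n) (1 - sqrt_major n).
Proof.
move=> x1; have [|||y yP] :=
  @multiplier_limit (sqrt_iter x) sqrt_major 1.
- by move=> m; apply: mbound_sqrt_step.
- by move=> m; have /andP[] := sqrt_major_itv m.
- exact: sqrt_major_cvg.
by rewrite /sqrt_lim; case: xgetP => [z _ /(_ n)//|/(_ y)/(_ yP)].
Qed.

Lemma mbound_sqrt_lim x : mbound x 1 -> mbound (sqrt_lim x) 1.
Proof. by move/(sqrt_limP 0%N); rewrite /= !subr0. Qed.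

Lemma sqrt_lim_eq x : mbound x 1 ->
  sqrt_lim x = mreal 2^-1 * (x + sqrt_lim x * sqrt_lim x).
Proof.
move=> x1; apply/subr0_eq/mbound_eq0 => e e0.
have [n sn] := sqrt_major_cvg (divr_gt0 e0 (ltr0n _ 2)).
set y := sqrt_lim x; set yn := sqrt_iter x n.
have -> : y - mreal 2^-1 * (x + y * y) =
    (y - sqrt_iter x n.+1) - mreal 2^-1 * (y * y - yn * yn).
  by rewrite /= -/yn !mulrDr mulrN !opprD opprK !addrA [RHS]addrAC subrK.
have d1 := sqrt_limP n.+1 x1.
have d2 := mboundM (mbound_real (ltac:(by rewrite invr_ge0) : 0 <= 2^-1))
  (mbound_sub_sqr (mbound_sqrt_lim x1) (mbound_sqrt_iter n x1) (sqrt_limP n x1)).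
apply: mbound_le (mboundB d1 d2).
have := sqrt_major_le n; have /andP[? ?] := sqrt_major_itv n.
rewrite -/(sqrt_major n.+1); nra.
Qed.

Lemma sqrt_lim_intertwine x x' w : mbound x 1 -> mbound x' 1 ->
  x * w = w * x' -> sqrt_lim x * w = w * sqrt_lim x'.
Proof.
move=> x1 x1' xw; have [C wC] := multiplier_bounded w.
have C0 : 0 <= C by case: wC.
have C1 : 0 < 1 + 2 * C by lra.
apply/subr0_eq/mbound_eq0 => e e0.
have [n sn] := sqrt_major_cvg (divr_gt0 e0 C1); rewrite ltr_pdivlMr// in sn.
have ynw : sqrt_iter x n * w = w * sqrt_iter x' n.
  elim: (n) => [|m IHm] /=; first by rewrite mul0r mulr0.
  rewrite -mulrA mulrDl xw -mulrA IHm mulrA IHm -mulrA -mulrDr.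
  by rewrite !mulrA mrealC.
have -> : sqrt_lim x * w - w * sqrt_lim x' =
    (sqrt_lim x - sqrt_iter x n) * w - w * (sqrt_lim x' - sqrt_iter x' n).
  by rewrite mulrBl mulrBr opprB ynw addrA subrK.
apply: mbound_le (mboundB (mboundM (sqrt_limP n x1) wC)
                          (mboundM wC (sqrt_limP n x1'))).
have /andP[? ?] := sqrt_major_itv n; nra.
Qed.

Lemma selfadjoint_sqrt_lim x : selfadjoint x -> mbound x 1 ->
  selfadjoint (sqrt_lim x).
Proof.
move=> sx x1; apply/subr0_eq/mbound_eq0 => e e0.
have [n sn] := sqrt_major_cvg (divr_gt0 e0 (ltr0n _ 2)).
have syn : selfadjoint (sqrt_iter x n).
  elim: (n) => [|m IHm] /=; first exact: mstar0.
  apply: selfadjoint_realM; apply: selfadjointD => //.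
  exact: selfadjointM.
have -> : (sqrt_lim x)^*m - sqrt_lim x =
    (sqrt_lim x - sqrt_iter x n)^*m - (sqrt_lim x - sqrt_iter x n).
  by rewrite mstarB syn opprB addrA subrK.
have d := sqrt_limP n x1.
by apply: mbound_le (mboundB (mbound_star d) d); lra.
Qed.

(** The square root of [h], for self-adjoint [h] with [mbound (t - h) t]; the
root does not depend on the scaling [t], which only serves to reduce the norm
of [1 - h / t] to at most [1]. *)
Definition mroot t h : multiplier A :=
  mreal (Num.sqrt t) * (1 - sqrt_lim (1 - mreal t^-1 * h)).

Lemma mbound_scaled t h : 0 < t -> mbound (mreal t - h) t ->
  mbound (1 - mreal t^-1 * h) 1.
Proof.
move=> t0 ht; have t1 : t^-1 * t = 1 by rewrite mulVf// gt_eqF.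
have -> : 1 - mreal t^-1 * h = mreal t^-1 * (mreal t - h).
  by rewrite mulrBr -mrealM t1 mreal1.
by rewrite -[X in mbound _ X]t1; apply: mboundM => //; apply: mbound_real;
  rewrite invr_ge0 ltW.
Qed.

Lemma mroot_sqr t h : 0 < t -> mbound (mreal t - h) t ->
  mroot t h * mroot t h = h.
Proof.
move=> t0 /(mbound_scaled t0); set x := 1 - _ => x1.
rewrite /mroot -/x; set y := sqrt_lim x; set r := Num.sqrt t.
have -> : mreal r * (1 - y) * (mreal r * (1 - y)) =
    mreal t * ((1 - y) * (1 - y)).
  by rewrite !mulrA -[_ * _ * mreal r]mulrA -mrealC !mulrA -mrealM -expr2 sqr_sqrtr// ltW.
have yy : y + y = x + y * y.
  rewrite {1 2}/y sqrt_lim_eq// -mulrDl -mrealD -/y.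
  by rewrite (_ : 2^-1 + 2^-1 = 1 :> R) ?mreal1 ?mul1r//; lra.
have -> : (1 - y) * (1 - y) = 1 - x.
  have -> : x = y + y - y * y by rewrite yy addrK.
  by rewrite mulrBr mulr1 mulrBl mul1r -addrA -opprD addrA.
by rewrite /x opprB addrC subrK mulrA -mrealM mulfV ?gt_eqF// mreal1 mul1r.
Qed.

Lemma selfadjoint_mroot t h : 0 < t -> mbound (mreal t - h) t ->
  selfadjoint h -> selfadjoint (mroot t h).
Proof.
move=> t0 ht sh; apply: selfadjoint_realM; apply: selfadjointB.
  exact: mstar1.
apply: selfadjoint_sqrt_lim; last exact: mbound_scaled.
by apply: selfadjointB; [exact: mstar1|exact: selfadjoint_realM].
Qed.

Lemma mroot_intertwine t h h' w : 0 < t -> mbound (mreal t - h) t ->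
  mbound (mreal t - h') t -> h * w = w * h' -> mroot t h * w = w * mroot t h'.
Proof.
move=> t0 ht ht' hw; rewrite /mroot -mulrA mulrBl mul1r.
rewrite (@sqrt_lim_intertwine _ (1 - mreal t^-1 * h')); try exact: mbound_scaled.
  by rewrite [RHS]mulrA -mrealC -[RHS]mulrA; congr (_ * _); rewrite mulrBr mulr1.
by rewrite mulrBl mulrBr mul1r mulr1 -mulrA hw !mulrA mrealC.
Qed.

Lemma mbound_mroot t h : 0 < t -> mbound (mreal t - h) t ->
  mbound (mreal (Num.sqrt t) - mroot t h) (Num.sqrt t).
Proof.
move=> t0 ht; rewrite /mroot mulrBr mulr1 opprB addrC subrK.
rewrite -[X in mbound _ X]mulr1; apply: mboundM; last first.
  exact/mbound_sqrt_lim/mbound_scaled.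
exact/mbound_real/sqrtr_ge0.
Qed.

End SquareRoot.

(** * Positive multipliers *)

Section Positive.
Context {R : realType} {A : cstarAlgType R}.
Implicit Types (h k p q u v w x : multiplier A) (C D t e : R).

(** For commuting self-adjoint [s] and [k], the multiplier [s + i k] is normal,
of norm at most [D], and [s] is the mean of it and its adjoint. *)
Lemma mbound_sqr_add s k D : selfadjoint s -> selfadjoint k -> s * k = k * s ->
  0 <= D -> mbound (s * s + k * k) (D ^+ 2) -> mbound s D.
Proof.
move=> ss sk skc D0 skD; pose n : multiplier A := s + mimag * k.
have nstar : n^*m = s - mimag * k.
  by rewrite mstarD mstarM mstar_mimag ss sk mulrN -mimagC.
have nD : mbound n D.
  apply: mbound_star_mul => //; rewrite nstar.
  have -> // : (s - mimag * k) * n = s * s + k * k.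
  rewrite mulrBl !mulrDr -!mulrA.
  rewrite [k * (mimag * k)]mulrA -mimagC -[mimag * k * k]mulrA.
  rewrite [mimag * (mimag * _)]mulrA mimag_sqr mulN1r opprD opprK addrA.
  by rewrite [s * (mimag * k)]mulrA -mimagC -mulrA skc addrK.
have -> : s = mreal 2^-1 * (n + n^*m).
  rewrite nstar addrACA subrr addr0 mulrDr -mulrDl -mrealD.
  by rewrite (_ : 2^-1 + 2^-1 = 1 :> R) ?mreal1 ?mul1r//; lra.
rewrite (_ : D = 2^-1 * (D + D)); last by lra.
by apply: mboundM; [apply: mbound_real; rewrite invr_ge0
                   |apply: mboundD => //; exact: mbound_star].
Qed.

Lemma sqr_add_eq0 s k : selfadjoint s -> selfadjoint k -> s * k = k * s ->
  s * s + k * k = 0 -> s = 0.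
Proof.
move=> ss sk skc sk0; apply: mbound_eq0 => e e0.
apply: (mbound_sqr_add ss sk skc (ltW e0)); rewrite sk0.
by apply: mbound_le (@mbound0 _ _); rewrite exprn_ge0// ltW.
Qed.

(** Positivity, expressed by the norm: the spectrum of a self-adjoint [h] lies
in [[0, 2 t]]. *)
Definition positive h := selfadjoint h /\ exists t, mbound (mreal t - h) t.

Lemma mbound_real_sub_le h t e : t <= e ->
  mbound (mreal t - h) t -> mbound (mreal e - h) e.
Proof.
move=> te ht; have -> : mreal e - h = mreal (e - t) + (mreal t - h).
  by rewrite mrealB addrA subrK.
have := mboundD (mbound_real (ltac:(by rewrite subr_ge0) : 0 <= e - t)) ht.
by rewrite subrK.
Qed.

Lemma positive_scale h h' : positive h -> positive h' ->
  exists t, [/\ 0 < t, mbound (mreal t - h) t & mbound (mreal t - h') t].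
Proof.
move=> [_ [t ht]] [_ [t' ht']]; exists (1 + t + t').
have t0 : 0 <= t by case: ht.
have t'0 : 0 <= t' by case: ht'.
split; first lra.
  by apply: mbound_real_sub_le ht; lra.
by apply: mbound_real_sub_le ht'; lra.
Qed.

Lemma positiveD h h' : positive h -> positive h' -> positive (h + h').
Proof.
move=> [sh [t ht]] [sh' [t' ht']]; split; first exact: selfadjointD.
exists (t + t'); have -> : mreal (t + t') - (h + h') =
    (mreal t - h) + (mreal t' - h').
  by rewrite mrealD opprD addrACA.
exact: mboundD.
Qed.

Lemma positive_mroot t h : 0 < t -> mbound (mreal t - h) t -> selfadjoint h ->
  positive (mroot t h).
Proof.
move=> t0 ht sh; split; first exact: selfadjoint_mroot.
by exists (Num.sqrt t); apply: mbound_mroot.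
Qed.

(** A positive multiplier is the square of a self-adjoint multiplier that
commutes with everything it commutes with. *)
Lemma positive_root h : positive h -> exists k, [/\ selfadjoint k, k * k = h &
  forall w, h * w = w * h -> k * w = w * k].
Proof.
move=> ph; have [sh _] := ph; have [t [t0 ht _]] := positive_scale ph ph.
exists (mroot t h); split; first exact: selfadjoint_mroot.
  exact: mroot_sqr.
by move=> w hw; apply: mroot_intertwine.
Qed.

(** Squares of self-adjoint multipliers are positive, with any scale [t]
that is at least the square of their norm. *)
Lemma mbound_real_sub_sqr k C t : selfadjoint k -> mbound k C -> 0 < t ->
  C ^+ 2 <= t -> mbound (mreal t - k * k) t.
Proof.
move=> sk kC t0 Ct; set x := mreal t - k * k.
have sx : selfadjoint x.
  by apply: selfadjointB; [exact: selfadjoint_real|exact: selfadjointM].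
have xt : mbound (mreal t - x) t.
  rewrite /x opprB addrC subrK.
  by apply: mbound_le Ct _; rewrite expr2; apply: mboundM.
set s := mroot t x.
have skc : s * k = k * s.
  by apply: mroot_intertwine => //; rewrite /x mulrBl mulrBr mrealC mulrA.
have s2 : s * s = x by apply: mroot_sqr.
have st : mbound s (Num.sqrt t).
  apply: (mbound_sqr_add _ sk skc); rewrite ?sqrtr_ge0//.
    exact: selfadjoint_mroot.
  by rewrite s2 /x subrK sqr_sqrtr ?ltW//; apply: mbound_real; rewrite ltW.
by rewrite -s2 -[t in mbound _ t](sqr_sqrtr (ltW t0)) expr2; apply: mboundM.
Qed.

Lemma positive_sqr k : selfadjoint k -> positive (k * k).
Proof.
move=> sk; split; first exact: selfadjointM.
have [C kC] := multiplier_bounded k; exists (1 + C ^+ 2).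
apply: (mbound_real_sub_sqr sk kC); have := sqr_ge0 C; lra.
Qed.

(** The norm is monotone on positive multipliers, here between [h] and [t]. *)
Lemma positive_mbound h t : 0 <= t -> positive h -> positive (mreal t - h) ->
  mbound h t.
Proof.
move=> t0 ph pth; have [k [sk kh kw]] := positive_root ph.
have [s [ss sth sw]] := positive_root pth.
have kt : mbound k (Num.sqrt t).
  apply: (@mbound_sqr_add k s); rewrite ?sqrtr_ge0//.
    by apply/esym/sw; rewrite -kh mulrBl mulrBr mrealC mulrA.
  by rewrite kh sth addrC subrK sqr_sqrtr//; apply: mbound_real.
by rewrite -kh -[t in mbound _ t](sqr_sqrtr t0) expr2; apply: mboundM.
Qed.

(** Uniqueness of positive square roots, among commuting ones. *)
Lemma positive_sqr_inj p q : positive p -> positive q -> p * q = q * p ->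
  p * p = q * q -> p = q.
Proof.
move=> pp pq pqc p2q2; have [[sp _] [sq _]] := (pp, pq).
have [k [sk kp kw]] := positive_root pp.
have [l [sl lq lw]] := positive_root pq.
pose d : multiplier A := p - q.
have sd : selfadjoint d by apply: selfadjointB.
have kd : k * d = d * k by apply: kw; rewrite /d mulrBr mulrBl pqc.
have ld : l * d = d * l by apply: lw; rewrite /d mulrBr mulrBl pqc.
have kl : k * l = l * k by apply: kw; rewrite [RHS]lw.
have dpq : d * (p + q) = 0.
  by rewrite /d mulrBl !mulrDr p2q2 pqc [_ + q * p]addrC subrr.
have kdld : GRing.comm (k * d) (l * d).
  have kdl : GRing.comm l (k * d) by apply: GRing.commrM => //; exact/esym.
  have kdd : GRing.comm d (k * d) by apply: GRing.commrM => //; exact/esym.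
  by apply: GRing.commrM; exact: GRing.commr_sym.
(* [(k d)^2 + (l d)^2 = d (p + q) d] vanishes, hence both squares do. *)
have kldd : k * d * (k * d) + l * d * (l * d) = 0.
  rewrite {1}kd {1}ld -!mulrA -mulrDr [k * _]mulrA [l * _]mulrA -mulrDl kp lq.
  by rewrite mulrA dpq mul0r.
have kd0 : k * d = 0.
  by apply: (@sqr_add_eq0 (k * d) (l * d)) => //; apply: selfadjointM.
have ld0 : l * d = 0.
  apply: (@sqr_add_eq0 (l * d) (k * d)) => //; try exact: selfadjointM.
  by rewrite addrC.
apply/subr0_eq/(selfadjoint_sqr_eq0 sd).
by rewrite -/d {1}/d mulrBl -kp -lq -!mulrA kd0 ld0 !mulr0 subrr.
Qed.

(** Square roots of positive multipliers respect intertwining. *)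
Lemma positive_sqr_intertwine p q w : positive p -> positive q ->
  p * p * w = w * (q * q) -> p * w = w * q.
Proof.
move=> pp pq pwq; have [[sp _] [sq _]] := (pp, pq).
have [Cp pC] := multiplier_bounded p; have [Cq qC] := multiplier_bounded q.
pose t := 1 + Cp ^+ 2 + Cq ^+ 2.
have [Cp2 Cq2] := (sqr_ge0 Cp, sqr_ge0 Cq).
have t0 : 0 < t by rewrite /t; lra.
have pt : mbound (mreal t - p * p) t.
  by apply: (mbound_real_sub_sqr sp pC); rewrite /t; lra.
have qt : mbound (mreal t - q * q) t.
  by apply: (mbound_real_sub_sqr sq qC); rewrite /t; lra.
have rootE h : positive h -> mbound (mreal t - h * h) t ->
    h = mroot t (h * h).
  move=> ph ht; have [sh _] := ph; apply: positive_sqr_inj => //.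
  - by apply: positive_mroot => //; apply: selfadjointM.
  - by apply/esym/mroot_intertwine => //; rewrite mulrA.
  - by rewrite mroot_sqr.
rewrite [in LHS](rootE p)// [in RHS](rootE q)//.
exact: mroot_intertwine.
Qed.

(** A multiplier that intertwines a positive multiplier with a negative one
is killed by them: the squares are intertwined, hence so are their roots. *)
Lemma positive_sylvester p q w : positive p -> positive q ->
  p * w = - (w * q) -> w * q = 0.
Proof.
move=> pp pq pwq; have pw : p * w = w * q.
  apply: positive_sqr_intertwine => //.
  by rewrite -[LHS]mulrA pwq mulrN [p * _]mulrA pwq mulNr opprK mulrA.
apply: (@mreal_inv _ _ 2); first by rewrite pnatr_eq0.
rewrite mulr0 mreal2M.
by rewrite -{1}pw pwq addNr.
Qed.

(** If [x^*m * x = - k^2] then [x x^*m], being the sum of [k^2] and of twice the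
squares of the real and imaginary parts of [x], is positive; the identity
[k^2 x^*m = - x^*m (x x^*m)] then forces [x = 0]. *)
Lemma star_mul_opp_sqr_eq0 x k : selfadjoint k -> x^*m * x = - (k * k) -> x = 0.
Proof.
move=> sk xk.
(* [a] and [b] are twice the real and imaginary parts of [x], up to sign. *)
pose a : multiplier A := x + x^*m; pose b : multiplier A := mimag * (x - x^*m).
have sa : selfadjoint a by rewrite /selfadjoint mstarD mstarK addrC.
have sb : selfadjoint b.
  rewrite /selfadjoint mstarM mstar_mimag mstarB mstarK mulrN -mimagC.
  by rewrite -mulrN opprB.
have ab : a * a + b * b = mreal 2 * (x * x^*m + x^*m * x).
  have -> : b * b = - ((x - x^*m) * (x - x^*m)).
    rewrite /b; set y := x - x^*m.
    by rewrite mulrA -[mimag * y * mimag]mulrA -mimagC mulrA mimag_sqr -mulrA mulN1r.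
  rewrite /a mreal2M.
  rewrite !mulrDl !mulrDr !mulrN !mulNr opprK.
  rewrite opprD [LHS]addrACA [RHS]addrACA; congr (_ + _).
    by rewrite opprB [x * x + _]addrC addrACA subrr addr0.
  by rewrite opprD opprK addrACA subrr addr0.
have pxx : positive (mreal 2 * (x * x^*m)).
  have -> : mreal 2 * (x * x^*m) = a * a + b * b + (k * k + k * k).
    rewrite ab mulrDr -addrA xk mulrN mreal2M.
    by rewrite [mreal 2 * (k * k)]mreal2M addNr addr0.
  by do !apply: positiveD; apply: positive_sqr.
have pkk : positive (mreal 2 * (k * k)).
  by rewrite mreal2M; apply: positiveD; apply: positive_sqr.
have := positive_sylvester (w := x^*m) pkk pxx.
rewrite [x^*m * (_ * _)]mulrA -mrealC -!mulrA => sylv.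
have {}sylv : mreal 2 * (x^*m * (x * x^*m)) = 0.
  apply: sylv; rewrite -mulrN; congr (_ * _).
  by rewrite [x^*m * (_ * _)]mulrA xk mulNr opprK mulrA.
have {}sylv : x^*m * (x * x^*m) = 0.
  by apply: (@mreal_inv _ _ 2); rewrite ?pnatr_eq0 ?mulr0.
apply: star_mul_eq0; apply: selfadjoint_sqr_eq0.
  by rewrite /selfadjoint mstarM mstarK.
by rewrite -!mulrA [x * (_ * _)]mulrA [x^*m * (_ * _)]mulrA sylv mul0r.
Qed.

(** Kaplansky's theorem: [x^*m * x] is positive. *)
Theorem positive_star_mul x : positive (x^*m * x).
Proof.
pose h : multiplier A := x^*m * x.
have sh : selfadjoint h by rewrite /selfadjoint mstarM mstarK.
have ph2 := positive_sqr sh.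
have [t [t0 ht _]] := positive_scale ph2 ph2.
pose m := mroot t (h * h).
have pm : positive m by apply: positive_mroot => //; apply: selfadjointM.
have m2 : m * m = h * h by apply: mroot_sqr.
have mh : m * h = h * m by apply: mroot_intertwine => //; rewrite mulrA.
have [s [ss sm sw]] := positive_root pm; have [smm _] := pm.
(* [d] is twice the negative part of [h]. *)
pose d : multiplier A := m - h.
have sd : selfadjoint d by apply: selfadjointB.
have dm : m * d = d * m by rewrite /d mulrBr mulrBl mh.
have hd : h * d = - (m * d).
  by rewrite /d !mulrBr -m2 -mh opprB.
have sdc : s * d = d * s by apply: sw.
have xd : x * d = 0.
  apply: (@star_mul_opp_sqr_eq0 _ (s * d)); first exact: selfadjointM.
  rewrite mstarM sd -mulrA [x^*m * _]mulrA -/h hd mulrN; congr (- _).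
  by rewrite {1}sdc -sm !mulrA.
suff d0 : d = 0 by rewrite -/h -(subr0_eq d0).
apply: (selfadjoint_sqr_eq0 sd).
have hd0 : h * d = 0 by rewrite /h -mulrA xd mulr0.
by rewrite {1}/d mulrBl hd0 subr0; apply: oppr_inj; rewrite oppr0 -hd0 hd.
Qed.

End Positive.

(** * Positive square roots and contractions *)

Section Contraction.
Context {R : realType} {A : cstarAlgType R}.
Implicit Types (h p q u v w z : multiplier A).

Lemma mpositiveP h : mpositive h <-> positive h.
Proof.
split=> [[c ->]|/positive_root[k [sk kh _]]]; first exact: positive_star_mul.
by exists k; rewrite sk kh.
Qed.

Lemma msqrtP h : positive h -> is_msqrt h (msqrt h).
Proof.
move=> ph; have [sh _] := ph; have [t [t0 ht _]] := positive_scale ph ph.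
apply: (@xgetPex _ 0 [set b | is_msqrt h b]); exists (mroot t h).
by split; [apply/mpositiveP/positive_mroot|exact: mroot_sqr].
Qed.

Lemma positive_defect z : mbound z 1 -> positive (1 - z * z^*m).
Proof.
move=> z1; split.
  by rewrite /selfadjoint mstarB mstarM mstarK mstar1.
exists 1; rewrite mreal1 opprB addrC subrK -[X in mbound _ X]mulr1.
exact/mboundM/mbound_star.
Qed.

(** A multiplier [z] is a contraction as soon as [1 - z^*m * z] is the square
of a self-adjoint multiplier. *)
Lemma mbound_of_defect z q : selfadjoint q -> q * q = 1 - z^*m * z ->
  mbound z 1.
Proof.
move=> sq qq; apply: mbound_star_mul => //; rewrite expr1n.
apply: positive_mbound => //; first exact: positive_star_mul.
by rewrite mreal1 -qq; exact: positive_sqr.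
Qed.

Lemma defect_intertwine z p q : positive p -> positive q ->
  p * p = 1 - z * z^*m -> q * q = 1 - z^*m * z -> p * z = z * q.
Proof.
move=> pp pq ppz qqz; apply: positive_sqr_intertwine => //.
by rewrite ppz qqz mulrBl mulrBr mul1r mulr1 mulrA.
Qed.

(** The column [(q, z)] represents isometrically the graph of the operator
[q a |-> z a], and [(p, z^*m)] that of its adjoint.  If the column [(q, z)] is
[(q', z')] times [w], then conversely the column [(p', z'^*m)] is [(p, z^*m)]
times [u^*m]. *)
Lemma adjoint_factor z q p z' q' p' w : selfadjoint p -> selfadjoint q ->
    p * z = z * q -> p' * z' = z' * q' ->
    q * q = 1 - z^*m * z -> p * p = 1 - z * z^*m ->
    q' * w = q -> z' * w = z ->
  let u := p' * p + z' * z^*m in u * z = z' /\ u * p = p'.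
Proof.
move=> sp sq pz pz' qq pp wq wz u.
have pz'q : p' * z = z' * q by rewrite -wz mulrA pz' -mulrA wq.
have zp : z^*m * p = q * z^*m by rewrite -[p in LHS]sp -mstarM pz mstarM sq.
rewrite /u !mulrDl -!mulrA pz zp pp; split.
  by rewrite mulrA pz'q -mulrA qq -mulrDr subrK mulr1.
by rewrite [z' * _]mulrA -pz'q -[in X in _ + X]mulrA -mulrDr subrK mulr1.
Qed.

End Contraction.

(** * Bounded transforms and extensions *)

Section Extension.
Context {R : realType} {A : cstarAlgType R}.
Implicit Types (T S : operator A) (q z w : multiplier A).

Lemma adjointP T y : dom (adjoint T) y -> is_adjoint_value T y (adjoint T y).
Proof. exact: (@xgetPex _ 0 [set z | is_adjoint_value T y z]). Qed.

(** The operator [T] is [q a |-> z a], with [q ^+ 2 = 1 - z^*m * z]; the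
preimage of [x] under [q] is explicit. *)
Lemma ztransformP T z : is_ztransform T z -> exists q,
  [/\ positive q, q * q = 1 - z^*m * z,
      forall a, dom T (mleft q a) /\ T (mleft q a) = mleft z a
    & forall x, dom T x -> x = mleft q (mleft q x + mleft z^*m (T x))].
Proof.
move=> [r [q [[Nr rN] [/mpositiveP pq qr] qz]]].
have [sq _] := pq; exists q.
(* [T^* T r a = a - r a], where [T r a = z q a] *)
have adjE a : is_adjoint_value T (mleft z (mleft q a)) (a - mleft r a).
  have [[dra dTra] Nra] := Nr a.
  have rE : mleft r a = mleft q (mleft q a) by rewrite -qr.
  have -> : mleft z (mleft q a) = T (mleft r a).
    by rewrite rE; have [_ ->] := qz (mleft q a).
  have -> : a - mleft r a = adjoint T (T (mleft r a)).
    by apply/esym/eqP; rewrite -subr_eq opprK addrC; apply/eqP.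
  exact: adjointP.
have qinj a : mleft q a = 0 -> a = 0.
  move=> qa; have [_ <-] := Nr a.
  have -> : mleft r a = mleft r 0 by rewrite -qr /= qa !mleft0.
  by have [_ ->] := Nr 0.
(* [q z^* T = 1 - q^2] on the domain of [T], the adjoint of the former *)
have domE x : dom T x -> mleft q (mleft z^*m (T x)) = mleft (1 - q * q) x.
  move=> dx; apply: (can_inj cstarK); apply: cstar_mulIl => a.
  have sqq : selfadjoint (1 - q * q).
    by rewrite /selfadjoint mstarB mstar1 mstarM sq.
  rewrite -[in LHS]sq inner_mstarr inner_mstarr.
  rewrite -[in RHS]sqq inner_mstarr.
  by have := adjE a x dx; rewrite /inner -qr.
split=> //.
  apply: mleft_inj => a; apply/eqP; rewrite -subr_eq0; apply/eqP/qinj.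
  have [dqa Tqa] := qz a; have := domE _ dqa; rewrite Tqa /= => E.
  by rewrite !mleftB E subKr subrr.
move=> x dx; rewrite mleftD domE //=.
by rewrite addrC subrK.
Qed.

(** For operators parametrized as in [ztransformP], [S] extends [T] exactly when
the parametrizations factor; the multiplier [w] is the explicit preimage
under [q'] of [q a], in terms of [a]. *)
Lemma extends_factor T S z q z' q' :
    (forall a, dom T (mleft q a) /\ T (mleft q a) = mleft z a) ->
    (forall x, dom T x -> x = mleft q (mleft q x + mleft z^*m (T x))) ->
    (forall a, dom S (mleft q' a) /\ S (mleft q' a) = mleft z' a) ->
    (forall x, dom S x -> x = mleft q' (mleft q' x + mleft z'^*m (S x))) ->
  extends S T <-> exists w, q' * w = q /\ z' * w = z.
Proof.
move=> Tq Tx Sq Sx; split=> [[TS ST]|[w [qw zw]]].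
  pose w : multiplier A := q' * q + z'^*m * z.
  have wE a : mleft q a = mleft q' (mleft w a).
    have [dqa Tqa] := Tq a.
    by rewrite [LHS]Sx ?ST ?Tqa//; exact: TS.
  exists w; split; apply: mleft_inj => a; first by rewrite wE.
  have [dqa <-] := Tq a; rewrite -ST// wE.
  by have [_ ->] := Sq (mleft w a).
have TE x : dom T x -> exists a, x = mleft q a by move/Tx => E; eexists; exact: E.
have SE a : dom S (mleft q a) /\ S (mleft q a) = mleft z a.
  by rewrite -qw -zw; exact: Sq.
split=> [x /TE[a ->]|x /TE[a ->]]; first by have [] := SE a.
by have [_ ->] := SE a; have [_ ->] := Tq a.
Qed.

End Extension.

Theorem proposition6p3 (R : realType) (A : cstarAlgType R)
    (sepA : separable A) (T S : operator A) (z zS : multiplier A)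
    (regT : regular T) (zT : is_ztransform T z)
    (regS : regular S) (zSS : is_ztransform S zS) :
  extends S T <->
  exists u : multiplier A,
    [/\ u * u^*m = 1,
        zS = u * z
      & msqrt (u * (1 - z * z^*m) * u^*m) = u * msqrt (1 - z * z^*m)].
Proof.
have [q [pq qq Tq Tx]] := ztransformP zT.
have [qS [pqS qqS Sq Sx]] := ztransformP zSS.
rewrite (extends_factor Tq Tx Sq Sx).
have [[sq _] [sqS _]] := (pq, pqS).
have [/mpositiveP pp ppE] := msqrtP (positive_defect (mbound_of_defect sq qq)).
have [/mpositiveP ppS ppSE] :=
  msqrtP (positive_defect (mbound_of_defect sqS qqS)).
set p := msqrt (1 - z * z^*m) in pp ppE *.
set pS := msqrt (1 - zS * zS^*m) in ppS ppSE.
have [[sp _] [spS _]] := (pp, ppS).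
have pz := defect_intertwine pp pq ppE qq.
have pzS := defect_intertwine ppS pqS ppSE qqS.
have defect_conj u : u * u^*m = 1 -> zS = u * z ->
    u * (1 - z * z^*m) * u^*m = 1 - zS * zS^*m.
  by move=> uu ->; rewrite mulrBr mulr1 mulrBl uu mstarM !mulrA.
split=> [[w [wq wz]]|[u [uu zSu]]].
  have [] := adjoint_factor sp sq pz pzS qq ppE wq wz.
  set u := pS * p + zS * z^*m => uz up; exists u.
  have uu : u * u^*m = 1.
    rewrite {2}/u mstarD !mstarM mstarK sp spS mulrDr !mulrA up uz.
    by rewrite ppSE subrK.
  by split; rewrite ?defect_conj.
rewrite defect_conj// -/pS => pSu.
have zq : q * z^*m = z^*m * p by rewrite -[p]sp -mstarM pz mstarM sq.
have zqS : qS * zS^*m = zS^*m * pS by rewrite -[pS]spS -mstarM pzS mstarM sqS.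
(* The adjoint of [T] extends that of [S], with the factor [u^*m]. *)
have [||||] := @adjoint_factor _ _ zS^*m pS qS z^*m p q u^*m sqS spS zqS zq.
- by rewrite ppSE mstarK.
- by rewrite qqS mstarK.
- by rewrite -[in LHS]sp -mstarM -pSu spS.
- by rewrite -mstarM -zSu.
move: (_ + _) => w wz wq; exists w^*m; split.
  by rewrite -[in LHS]sqS -mstarM wq sq.
by rewrite -[zS]mstarK -mstarM wz mstarK.
Qed.
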